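(* Suppose $L\ge s$, $M-L+1\ge s$, and $$\mathcal P_2[\phi^L(\omega)]'\big|_{\omega=\omega_j}\neq\mathbf 0\qquad\text{for all }\omega_j\in\mathcal S .$$ Let $Q(\omega)=R^2(\omega)$, $\eta(L)=2\pi\sqrt{1^2+2^2+\dots+L^2}/\sqrt{L+1}$, $\zeta(L)=(2\pi)^2\sqrt{1^4+2^4+\dots+L^4}/\sqrt{L+1}$, and, for $\|E\|_2<\sigma_s$, $$\alpha=\frac{4\sigma_1+2\|E\|_2}{(\sigma_s-\|E\|_2)^2}.$$ For $\omega_j\in\mathcal S$ let $m_j=\tfrac12Q''(\omega_j)$ (which is positive), and let $\delta_j>0$ be such that $Q''(\omega)>m_j$ for all $\omega\in(\omega_j-\delta_j,\omega_j+\delta_j)$. If $\|E\|_2$ is sufficiently small, in the sense that $\|E\|_2<\sigma_s$, $$4\alpha\,[\eta^2(L)+\zeta(L)]\,\|E\|_2<\frac{m_j}{2}\qquad\text{and}\qquad 4\alpha\,\eta(L)\,\|E\|_2<\frac{m_j\delta_j}{2},$$ then there exists a strict local minimizer $\hat\omega_j\in(\omega_j-\delta_j,\omega_j+\delta_j)$ of $R^\varepsilon(\omega)$ such that $$|\hat\omega_j-\omega_j|\,\min_{\xi\in(\omega_j,\hat\omega_j)}|Q''(\xi)|\le4\alpha\,\eta(L)\,\|E\|_2 ,$$ where $(\omega_j,\hat\omega_j)$ denotes the open interval with endpoints $\omega_j$ and $\hat\omega_j$ (in either order), the minimum is understood as an infimum, and the left-hand side is $0$ if $\hat\omega_j=\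omega_j$.
   Context: Setting. Let $s,L,M$ be positive integers with $1\le L<M$. Let $\mathcal S=\{\omega_1,\dots,\omega_s\}\subset[0,1)$ be $s$ distinct frequencies and $x_1,\dots,x_s\in\mathbb C\setminus\{0\}$ amplitudes. Put $\phi^{L}(\omega)=[1,\ e^{-2\pi i\omega},\dots,e^{-2\pi iL\omega}]^T\in\mathbb C^{L+1}$ for $\omega\in\mathbb R$, and $[\phi^L(\omega)]'=d\phi^L(\omega)/d\omega$. The noiseless data are $y_k=\sum_{j=1}^s x_je^{-2\pi ik\omega_j}$, $k=0,\dots,M$; $\varepsilon=(\varepsilon_k)_{k=0}^M\in\mathbb C^{M+1}$ is a noise vector and $y^\varepsilon=y+\varepsilon$. For $v\in\mathbb C^{M+1}$, $\mathrm{Hankel}(v)\in\mathbb C^{(L+1)\times(M-L+1)}$ has entries $v_{a+b}$, $0\le a\le L$, $0\le b\le M-L$. Put $H=\mathrm{Hankel}(y)$, $E=\mathrm{Hankel}(\varepsilon)$, $H^\varepsilon=\mathrm{Hankel}(y^\varepsilon)=H+E$. Write singular value decompositions (singular values in nonincreasing order) $H=[U_1\ U_2]\,\mathrm{diag}(\sigma_1,\dots,\sigma_s,0,\dots,0)\,[V_1\ V_2]^\star$ with $\sigma_1\ge\dots\ge\sigma_s>0$, and $H^\varepsilon=[U_1^\varepsilon\ U_2^\varepsilon]\,\mathrm{diag}(\sigma_1^\varepsilon,\sigma_2^\varepsilon,\dots)\,[V_1^\varepsilon\ V_2^\varepsilon]^\star$, where $U_1,U_1^\varepsilon$ have $s$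 columns and $U_2,U_2^\varepsilon$ have $L+1-s$ columns. Put $\mathcal P_2=U_2U_2^\star$, $\mathcal P_2^\varepsilon=U_2^\varepsilon(U_2^\varepsilon)^\star$ and, for $\omega\in\mathbb R$ (these are $1$-periodic functions), $$R(\omega)=\frac{\|\mathcal P_2\phi^L(\omega)\|_2}{\|\phi^L(\omega)\|_2},\qquad R^\varepsilon(\omega)=\frac{\|\mathcal P^\varepsilon_2\phi^L(\omega)\|_2}{\|\phi^L(\omega)\|_2}.$$ $\|E\|_2$ is the spectral norm of $E$. *)

(* Defs.v *)
From mathcomp Require Export all_boot all_order all_algebra.
From mathcomp Require Export complex.
From mathcomp Require Export all_classical all_reals all_analysis.

Set Implicit Arguments.
Unset Strict Implicit.
Unset Printing Implicit Defensive.

Import Order.TTheory GRing.Theory Num.Theory.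
Import numFieldNormedType.Exports.

Local Open Scope classical_set_scope.
Local Open Scope ring_scope.
Local Open Scope complex_scope.
Local Open Scope sesquilinear_scope.

Section LinearAlgebra.
Variable R : realType.
Local Notation C := R[i].

Definition l2norm n (v : 'cV[C]_n) : R :=
  Num.sqrt (\sum_(i < n) ComplexField.Normc.normc (v i 0) ^+ 2).

Definition spectral_norm m n (A : 'M[C]_(m, n)) : R :=
  sup [set l2norm (A *m v) | v in [set v : 'cV[C]_n | l2norm v <= 1]].

Definition rect_diag m n (sigma : nat -> R) : 'M[C]_(m, n) :=
  \matrix_(i, j) if i == j :> nat then (sigma i)%:C else 0.

(* [sigma k] is the (k+1)-st largest singular value; the values of [sigma]
   beyond [minn m n] are irrelevant. *)
Definition is_svd m n (A : 'M[C]_(m, n))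
    (U : 'M[C]_m) (sigma : nat -> R) (V : 'M[C]_n) : Prop :=
  [/\ U \is unitarymx, V \is unitarymx,
      (forall k, (k < minn m n)%N -> 0 <= sigma k),
      (forall k l, (k <= l)%N -> (l < minn m n)%N -> sigma l <= sigma k) &
      A = U *m rect_diag m n sigma *m V ^t*].

(* The columns of [U] of index at least [s]: the block U_2 of U = [U_1 U_2],
   where U_1 has [s] columns. *)
Definition last_cols L s (U : 'M[C]_L.+1) : 'M[C]_(L.+1, L.+1 - s) :=
  colsub (fun k : 'I_(L.+1 - s) => inord (s + k)) U.

Definition noise_proj L s (U : 'M[C]_L.+1) : 'M[C]_L.+1 :=
  last_cols s U *m (last_cols s U) ^t*.

(* No index overflow occurs in [inord] as long as [L <= M]. *)
Definition hankel M L (v : 'cV[C]_M.+1) : 'M[C]_(L.+1, (M - L).+1) :=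
  \matrix_(a, b) v (inord (a + b)) 0.

End LinearAlgebra.

Section Imaging.
Variable R : realType.
Local Notation C := R[i].

Definition expi (t : R) : C := cos t +i* sin t.

Definition phi L (w : R) : 'cV[C]_L.+1 :=
  \col_(k < L.+1) expi (- (2 * pi * k%:R * w)).

(* Entrywise derivative, through real and imaginary parts. *)
Definition vderive n (f : R -> 'cV[C]_n) (w : R) : 'cV[C]_n :=
  \col_(k < n) (derive1 (fun t => complex.Re (f t k 0)) w
                +i* derive1 (fun t => complex.Im (f t k 0)) w).

Definition data M s (x : 'I_s -> C) (omega : 'I_s -> R) : 'cV[C]_M.+1 :=
  \col_(k < M.+1) \sum_(j < s) x j * expi (- (2 * pi * k%:R * omega j)).

Definition noise_corr L s (U : 'M[C]_L.+1) (w : R) : R :=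
  l2norm (noise_proj s U *m phi L w) / l2norm (phi L w).

Definition eta L : R :=
  2 * pi * Num.sqrt (\sum_(1 <= k < L.+1) k%:R ^+ 2) / Num.sqrt L.+1%:R.

Definition zeta L : R :=
  (2 * pi) ^+ 2 * Num.sqrt (\sum_(1 <= k < L.+1) k%:R ^+ 4)
    / Num.sqrt L.+1%:R.

Definition strict_local_minimizer (f : R -> R) (a : R) : Prop :=
  \forall t \near a^', f a < f t.

End Imaging.

Arguments eta {R} L.
Arguments zeta {R} L.

(* Main.v *)
(** Write P and Pe for the noise projections of H and of H + E, and
    e = ||E||.  From Pe - P = Pe (1 - P) - (1 - Pe) P, the range of 1 - P being
    that of H, and Weyl's inequality for singular values, one gets
    ||Pe - P|| <= 3 e / (sigma_s - e) <= 2 alpha e.  Since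
    Q(w) = <phi, P phi> / (L + 1), and similarly for the perturbed function Qe,
    the first two derivatives of Qe - Q are at most 4 alpha eta e and
    4 alpha (eta^2 + zeta) e.  Hence Qe'' > m/2 > 0 on the interval, whereas
    Q'(omega_j) = 0 and Q'' > m force Qe' to change sign between
    omega_j - delta/2 and omega_j + delta/2.  The zero of Qe' is the minimizer;
    applying the mean value theorem to Q' locates it.  At omega_j one has
    P phi = 0: since the Vandermonde factors of H have full rank,
    phi(omega_j) lies in the range of H. *)

Require Import Defs.
From mathcomp Require Import ring lra.

Set Implicit Arguments.
Unset Strict Implicit.
Unset Printing Implicit Defensive.

Import Order.TTheory GRing.Theory Num.Theory.
Import numFieldNormedType.Exports.

Local Open Scope classical_set_scope.
Local Open Scope ring_scope.
Local Open Scope complex_scope.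
Local Open Scope sesquilinear_scope.

(** * The real inner product on complex vectors *)

Section RealInnerProduct.
Variable R : realType.
Local Notation C := R[i].

(** The real part of the Hermitian product turns complex vectors into a real Euclidean space. For a
    self-adjoint matrix the quadratic form is real, so nothing is lost, and all calculus below stays
    over the reals. *)
Definition rdot n (u v : 'cV[C]_n) : R := complex.Re ((u ^t* *m v) 0 0).

Lemma rdotE n (u v : 'cV[C]_n) :
  rdot u v = \sum_k complex.Re ((u k 0)^* * v k 0).
Proof.
rewrite /rdot mxE raddf_sum /=; apply: eq_bigr => k _.
by rewrite !mxE.
Qed.

Lemma sqr_normcE (z : C) : ComplexField.Normc.normc z ^+ 2 = complex.Re (z^* * z).
Proof.
case: z => a b; rewrite /= sqr_sqrtr ?addr_ge0 ?sqr_ge0 //.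
by rewrite !expr2 mulNr opprK.
Qed.

Lemma normc_nonneg (z : C) : 0 <= ComplexField.Normc.normc z.
Proof. by case: z => a b; exact: sqrtr_ge0. Qed.

Lemma l2norm_ge0 n (u : 'cV[C]_n) : 0 <= l2norm u.
Proof. exact: sqrtr_ge0. Qed.

Lemma sqr_l2norm n (u : 'cV[C]_n) :
  l2norm u ^+ 2 = \sum_k ComplexField.Normc.normc (u k 0) ^+ 2.
Proof. by rewrite sqr_sqrtr // sumr_ge0 // => k _; exact: sqr_ge0. Qed.

Lemma rdotvv n (u : 'cV[C]_n) : rdot u u = l2norm u ^+ 2.
Proof.
by rewrite rdotE sqr_l2norm; apply: eq_bigr => k _; rewrite sqr_normcE.
Qed.

Lemma rdotC n (u v : 'cV[C]_n) : rdot u v = rdot v u.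
Proof.
rewrite !rdotE; apply: eq_bigr => k _.
by case: (u k 0) (v k 0) => [a b] [c d] /=; ring.
Qed.

Lemma rdotDr n (u v w : 'cV[C]_n) : rdot u (v + w) = rdot u v + rdot u w.
Proof. by rewrite /rdot mulmxDr mxE raddfD. Qed.

Lemma rdotNr n (u v : 'cV[C]_n) : rdot u (- v) = - rdot u v.
Proof. by rewrite /rdot mulmxN mxE raddfN. Qed.

Lemma rdotBr n (u v w : 'cV[C]_n) : rdot u (v - w) = rdot u v - rdot u w.
Proof. by rewrite rdotDr rdotNr. Qed.

Lemma rdotDl n (u v w : 'cV[C]_n) : rdot (v + w) u = rdot v u + rdot w u.
Proof. by rewrite rdotC rdotDr !(rdotC u). Qed.

Lemma rdotZr n (a : R) (u v : 'cV[C]_n) : rdot u (a%:C *: v) = a * rdot u v.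
Proof.
rewrite /rdot -scalemxAr mxE; case: ((_ *m _) 0 0) => c d /=.
by rewrite mul0r subr0.
Qed.

Lemma rdotZl n (a : R) (u v : 'cV[C]_n) : rdot (a%:C *: u) v = a * rdot u v.
Proof. by rewrite rdotC rdotZr rdotC. Qed.

Lemma rdot_mulmx m n (A : 'M[C]_(m, n)) (u : 'cV[C]_m) (v : 'cV[C]_n) :
  rdot u (A *m v) = rdot (A ^t* *m u) v.
Proof. by rewrite /rdot trmx_mul map_mxM /= trmxCK mulmxA. Qed.

Lemma rdot_mulmx_diff m n (A B : 'M[C]_(m, n)) (u : 'cV[C]_m) (v : 'cV[C]_n) :
  rdot u ((A - B) *m v) = rdot u (A *m v) - rdot u (B *m v).
Proof. by rewrite mulmxBl rdotBr. Qed.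

Lemma l2norm_eq0 n (u : 'cV[C]_n) : l2norm u = 0 -> u = 0.
Proof.
move=> u0; apply/matrixP => i j; rewrite ord1 mxE.
have := sqr_l2norm u; rewrite u0 expr0n /= => /esym/eqP.
rewrite psumr_eq0 => [|k _]; last exact: sqr_ge0.
move=> /allP /(_ i (mem_index_enum _)) /=; rewrite sqrf_eq0 => /eqP.
exact: ComplexField.Normc.eq0_normc.
Qed.

Lemma l2norm0 n : l2norm (0 : 'cV[C]_n) = 0.
Proof.
apply/eqP; rewrite -sqrf_eq0 -rdotvv; apply/eqP.
by rewrite /rdot mulmx0 mxE.
Qed.

Lemma l2norm_gt0 n (u : 'cV[C]_n) : u != 0 -> 0 < l2norm u.
Proof.
move=> u0; rewrite lt_def l2norm_ge0 andbT.
by apply: contra u0 => /eqP /l2norm_eq0 ->.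
Qed.

Lemma ler_sqr_l2norm n m (u : 'cV[C]_n) (v : 'cV[C]_m) (K : R) :
  0 <= K -> l2norm u ^+ 2 <= K ^+ 2 * l2norm v ^+ 2 -> l2norm u <= K * l2norm v.
Proof.
move=> K0; rewrite -exprMn ler_pXn2r // nnegrE ?mulr_ge0 ?l2norm_ge0 //.
Qed.

Lemma rdot_le n (u v : 'cV[C]_n) : `|rdot u v| <= l2norm u * l2norm v.
Proof.
have [->|v0] := eqVneq v 0.
  by rewrite /rdot mulmx0 mxE /= normr0 mulr_ge0 ?l2norm_ge0.
set p := rdot u v; set b := l2norm v.
have b0 : 0 < b by exact: l2norm_gt0.
rewrite -(@ler_pXn2r _ 2) // ?nnegrE ?mulr_ge0 ?l2norm_ge0 //.
rewrite real_normK ?num_real //.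
(* The vector b^2 u - p v is b^2 times the part of u orthogonal to v for [rdot]. Its squared norm
   expands to b^2 (|u|^2 b^2 - p^2), which gives Cauchy-Schwarz. *)
have := sqr_ge0 (l2norm ((b ^+ 2)%:C *: u - p%:C *: v)).
rewrite -rdotvv rdotBr (rdotC (_ - _)) rdotBr (rdotC (_ - _)) rdotBr.
rewrite !rdotZr !rdotZl !rdotvv (rdotC v u) -/p -/b exprMn => h.
have : 0 <= b ^+ 2 * (l2norm u ^+ 2 * b ^+ 2 - p ^+ 2) by lra.
by rewrite pmulr_rge0 ?exprn_gt0 // subr_ge0.
Qed.

Lemma l2normD n (u v : 'cV[C]_n) : l2norm (u + v) <= l2norm u + l2norm v.
Proof.
rewrite -(@ler_pXn2r _ 2) // ?nnegrE ?addr_ge0 ?l2norm_ge0 //.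
rewrite -rdotvv rdotDr !rdotDl !rdotvv (rdotC v u) sqrrD.
have := rdot_le u v; rewrite ler_norml => /andP[_ h]; lra.
Qed.

Lemma l2normN n (u : 'cV[C]_n) : l2norm (- u) = l2norm u.
Proof.
apply/eqP; rewrite -(@eqrXn2 _ 2) ?l2norm_ge0 // -!rdotvv.
by rewrite rdotNr rdotC rdotNr opprK.
Qed.

Lemma l2normZ n (c : C) (u : 'cV[C]_n) :
  l2norm (c *: u) = ComplexField.Normc.normc c * l2norm u.
Proof.
apply/eqP; rewrite -(@eqrXn2 _ 2) ?mulr_ge0 ?l2norm_ge0 ?normc_nonneg //.
rewrite exprMn !sqr_l2norm mulr_sumr; apply/eqP/eq_bigr => k _.
by rewrite !mxE ComplexField.Normc.normcM exprMn.
Qed.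

Lemma l2norm_sum n (I : finType) (F : I -> 'cV[C]_n) :
  l2norm (\sum_i F i) <= \sum_i l2norm (F i).
Proof.
elim/big_ind2: _ => [|x1 x2 y1 y2 h1 h2|//]; first by rewrite l2norm0.
by apply: le_trans (l2normD _ _) _; exact: lerD.
Qed.

Lemma normc_le_l2norm n (u : 'cV[C]_n) k :
  ComplexField.Normc.normc (u k 0) <= l2norm u.
Proof.
rewrite -(@ler_pXn2r _ 2) // ?nnegrE ?l2norm_ge0 ?normc_nonneg //.
rewrite sqr_l2norm (bigD1 k) //= lerDl sumr_ge0 // => i _; exact: sqr_ge0.
Qed.

Lemma normcR (a : R) : ComplexField.Normc.normc a%:C = `|a|.
Proof. by rewrite /= expr0n /= addr0 sqrtr_sqr. Qed.

Lemma l2norm_isometry m n (A : 'M[C]_(m, n)) (u : 'cV[C]_n) :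
  A ^t* *m A = 1%:M -> l2norm (A *m u) = l2norm u.
Proof.
move=> A1; apply/eqP; rewrite -(@eqrXn2 _ 2) ?l2norm_ge0 // -!rdotvv.
by rewrite rdot_mulmx mulmxA A1 mul1mx.
Qed.

Lemma unitarymxK n (U : 'M[C]_n) : U \is unitarymx -> U ^t* *m U = 1%:M.
Proof. by move=> Uu; apply: mulmx1C; exact/unitarymxP. Qed.

Lemma l2norm_unitary n (U : 'M[C]_n) (u : 'cV[C]_n) :
  U \is unitarymx -> l2norm (U *m u) = l2norm u.
Proof. by move=> /unitarymxK /l2norm_isometry. Qed.

Lemma l2norm_adj_unitary n (U : 'M[C]_n) (u : 'cV[C]_n) :
  U \is unitarymx -> l2norm (U ^t* *m u) = l2norm u.
Proof. by rewrite -trmxC_unitary; exact: l2norm_unitary. Qed.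

(** [sup] is meaningful only on a nonempty set bounded above. Coordinates of a vector in the unit
    ball have modulus at most 1, so the sum of the column norms is an upper bound. *)
Lemma spectral_norm_has_sup m n (A : 'M[C]_(m, n)) :
  has_sup [set l2norm (A *m v) | v in [set v : 'cV[C]_n | l2norm v <= 1]].
Proof.
split; first by exists (l2norm (A *m 0)), 0 => //=; rewrite l2norm0.
exists (\sum_j l2norm (col j A)) => _ /= [v v1 <-].
have -> : A *m v = \sum_j v j 0 *: col j A.
  apply/matrixP => i k; rewrite ord1 mxE summxE; apply: eq_bigr => j _.
  by rewrite !mxE mulrC.
apply: le_trans (l2norm_sum _) _; apply: ler_sum => j _.
rewrite l2normZ ler_piMl ?l2norm_ge0 //.
exact: le_trans (normc_le_l2norm _ _) v1.
Qed.

Lemma l2norm_mulmx_le m n (A : 'M[C]_(m, n)) (v : 'cV[C]_n) :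
  l2norm (A *m v) <= spectral_norm A * l2norm v.
Proof.
have [->|v0] := eqVneq v 0; first by rewrite mulmx0 !l2norm0 mulr0.
have nv0 := l2norm_gt0 v0.
rewrite -ler_pdivrMr //.
have -> : l2norm (A *m v) / l2norm v = l2norm (A *m ((l2norm v)^-1%:C *: v)).
  by rewrite -scalemxAr l2normZ normcR ger0_norm ?invr_ge0 ?l2norm_ge0 // mulrC.
apply: sup_ubound; first by case: (spectral_norm_has_sup A).
exists ((l2norm v)^-1%:C *: v) => //=.
by rewrite l2normZ normcR ger0_norm ?invr_ge0 ?l2norm_ge0 // mulVf // gt_eqF.
Qed.

Lemma spectral_norm_ge0 m n (A : 'M[C]_(m, n)) : 0 <= spectral_norm A.
Proof.
apply: sup_ubound; first by case: (spectral_norm_has_sup A).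
by exists 0 => /=; rewrite ?mulmx0 l2norm0.
Qed.

Lemma spectral_normN m n (A : 'M[C]_(m, n)) : spectral_norm (- A) = spectral_norm A.
Proof.
rewrite /spectral_norm; congr sup; apply/seteqP.
by split=> _ /= [w w1 <-]; exists w => //; rewrite mulNmx l2normN.
Qed.

End RealInnerProduct.

(** * Weyl's inequality *)

Section SingularValues.
Variable R : realType.
Local Notation C := R[i].
Local Notation normc := ComplexField.Normc.normc.

(** Stated as a sum with at most one term, so that the rows beyond the last column, where the sum is
    empty, need no separate case later. *)
Lemma rect_diag_mulmxE m n (sigma : nat -> R) (c : 'cV[C]_n) (i : 'I_m) :
  normc ((rect_diag m n sigma *m c) i 0) ^+ 2 =
  \sum_(j < n | i == j :> nat) sigma j ^+ 2 * normc (c j 0) ^+ 2.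
Proof.
rewrite mxE; have [ltin|leni] := ltnP i n.
  rewrite [RHS](big_pred1 (Ordinal ltin)) => [|j]; last by rewrite /= -val_eqE eq_sym.
  rewrite (bigD1 (Ordinal ltin)) //= big1 => [|j neqj]; last first.
    rewrite mxE; case: eqP => [eqij|]; last by rewrite mul0r.
    by case/eqP: neqj; apply: val_inj.
  by rewrite addr0 mxE eqxx ComplexField.Normc.normcM normcR exprMn real_normK ?num_real.
have neq (j : 'I_n) : (i == j :> nat) = false.
  by apply: contraTF (ltn_ord j) => /eqP <-; rewrite -leqNgt.
rewrite [in RHS]big_pred0 // big1 => [|j _]; last by rewrite mxE neq mul0r.
by rewrite (normcR 0) normr0 expr0n.
Qed.

Lemma sqr_l2norm_rect_diag m n (sigma : nat -> R) (c : 'cV[C]_n) :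
  l2norm (rect_diag m n sigma *m c) ^+ 2 =
  \sum_(j < n | (j < m)%N) sigma j ^+ 2 * normc (c j 0) ^+ 2.
Proof.
rewrite sqr_l2norm; under eq_bigr => i _ do rewrite rect_diag_mulmxE.
rewrite (exchange_big_dep xpredT) //= [RHS]big_mkcond /=.
apply: eq_bigr => j _; case: ltnP => [ltjm|lemj].
  by rewrite (big_pred1 (Ordinal ltjm)).
rewrite big_pred0 // => i.
by apply: contraTF (ltn_ord i) => /eqP ->; rewrite -leqNgt.
Qed.

(** The alternative [c j 0 = 0] restricts the bound to the span of chosen singular vectors, which is
    what [weyl] needs. *)
Lemma l2norm_rect_diag_le m n (sigma : nat -> R) (c : 'cV[C]_n) (K : R) :
  0 <= K -> (forall j : 'I_n, (j < m)%N -> 0 <= sigma j <= K \/ c j 0 = 0) ->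
  l2norm (rect_diag m n sigma *m c) <= K * l2norm c.
Proof.
move=> K0 leK; apply: ler_sqr_l2norm => //.
rewrite sqr_l2norm_rect_diag big_mkcond sqr_l2norm mulr_sumr.
apply: ler_sum => j _; case: ifP => [/leK|_]; last by rewrite mulr_ge0 ?sqr_ge0.
case=> [/andP[s0 sK]|->]; last by rewrite (normcR 0) normr0 expr0n !mulr0.
by rewrite ler_wpM2r ?sqr_ge0 // ler_pXn2r.
Qed.

Lemma l2norm_rect_diag_ge m n (sigma : nat -> R) (c : 'cV[C]_n) (K : R) :
  0 <= K -> (forall j : 'I_n, (j < m)%N && (K <= sigma j) \/ c j 0 = 0) ->
  K * l2norm c <= l2norm (rect_diag m n sigma *m c).
Proof.
move=> K0 geK.
rewrite -(@ler_pXn2r _ 2) // ?nnegrE ?mulr_ge0 ?l2norm_ge0 // exprMn.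
rewrite sqr_l2norm_rect_diag big_mkcond sqr_l2norm mulr_sumr.
apply: ler_sum => j _; case: (geK j) => [/andP[-> Ks]|->].
  by rewrite ler_wpM2r ?sqr_ge0 // ler_pXn2r // nnegrE (le_trans K0).
by rewrite (normcR 0) normr0 expr0n !mulr0 if_same.
Qed.

(** A dimension count: the first k + 1 coordinates of c are free and only k linear equations are
    imposed on them. *)
Lemma exists_flag_kernel n (G : 'M[C]_n) (k : nat) : (k < n)%N ->
  exists c : 'cV[C]_n, [/\ c != 0, forall i : 'I_n, (k < i)%N -> c i 0 = 0 &
    forall i : 'I_n, (i < k)%N -> (G *m c) i 0 = 0].
Proof.
move=> ltkn.
(* The top left k by k + 1 block of G, transposed because [kermx] is a left kernel. Its rank is at
   most k, so the kernel is nonzero. *)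
pose N : 'M[C]_(k.+1, k) := ((pid_mx k : 'M[C]_(k, n)) *m G *m (pid_mx k.+1 : 'M[C]_(n, k.+1)))^T.
have : kermx N != 0.
  rewrite -mxrank_eq0 mxrank_ker subn_eq0 -ltnNge ltnS.
  exact: rank_leq_col.
case/rowV0Pn => v /sub_kermxP vN v0.
exists (pid_mx k.+1 *m v^T); split.
- apply: contra v0 => /eqP h; rewrite -trmx_eq0 -(mul1mx v^T) -(pid_mx_1 _ k.+1).
  by rewrite -(@pid_mx_id _ _ n) // -mulmxA h mulmx0.
- move=> i ltki; rewrite mxE big1 // => j _.
  by rewrite mxE ltnS leqNgt ltki andbF mul0r.
- move=> i ltik.
  transitivity ((v *m N) 0 (Ordinal ltik)); last by rewrite vN mxE.
  rewrite -[v *m N]trmxK trmx_mul /N trmxK [RHS]mxE.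
  rewrite -!mulmxA [RHS]mxE (bigD1 i) //= big1 => [|j neqj].
    by rewrite [pid_mx _ _ _]mxE eqxx ltik mul1r addr0.
  rewrite mxE /=; case: eqP => [eqij|]; last by rewrite mul0r.
  by case/eqP: neqj; apply: val_inj.
Qed.

(** Some nonzero v lies in the span of the first k + 1 right singular vectors of A and is orthogonal
    to the first k of B. Then |A v| >= [sA k] |v| and |B v| <= [sB k] |v|, and the two differ by at
    most the norm of (A - B) v. *)
Lemma weyl m n (A B : 'M[C]_(m, n)) UA sA VA UB sB VB k :
  is_svd A UA sA VA -> is_svd B UB sB VB -> (k < minn m n)%N ->
  sA k <= sB k + spectral_norm (A - B).
Proof.
move=> [UAu VAu sA0 sAmono EA] [UBu VBu sB0 sBmono EB] ltk.
have [ltkm ltkn] : (k < m /\ k < n)%N by apply/andP; rewrite -leq_min.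
have [c [c0 chigh clow]] := exists_flag_kernel (VB ^t* *m VA) ltkn.
pose v := VA *m c.
have nv : l2norm v = l2norm c by exact: l2norm_unitary.
have nA : sA k * l2norm c <= l2norm (A *m v).
  rewrite EA /v -!mulmxA (mulmxA (VA ^t*)) unitarymxK // mul1mx l2norm_unitary //.
  apply: l2norm_rect_diag_ge => [|j]; first exact: sA0.
  have [ltkj|lejk] := ltnP k j; first by right; exact: chigh.
  by left; rewrite (leq_ltn_trans lejk ltkm) sAmono.
have nB : l2norm (B *m v) <= sB k * l2norm c.
  rewrite EB /v -!mulmxA l2norm_unitary // -(l2norm_unitary c VAu).
  rewrite -(l2norm_adj_unitary (VA *m c) VBu).
  apply: l2norm_rect_diag_le => [|j ltjm]; first exact: sB0.
  have [ltjk|lekj] := ltnP j k; first by right; rewrite mulmxA clow.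
  have ltj : (j < minn m n)%N by rewrite leq_min ltjm ltn_ord.
  by left; rewrite sB0 // sBmono.
rewrite -(ler_pM2r (l2norm_gt0 c0)) mulrDl (le_trans nA) //.
have -> : A *m v = B *m v + (A - B) *m v by rewrite -mulmxDl addrC subrK.
apply: le_trans (l2normD _ _) _; rewrite lerD // -nv.
exact: l2norm_mulmx_le.
Qed.

End SingularValues.

(** * Perturbation of the noise projection *)

Section NoiseProjection.
Variable R : realType.
Local Notation C := R[i].

Lemma copid_mulmxE m n s (X : 'M[C]_(m, n)) i j :
  (copid_mx s *m X) i j = if (i < s)%N then 0 else X i j.
Proof.
rewrite mulmxBl mul1mx !mxE (bigD1 i) //= big1 => [|l neql].
  by rewrite mxE eqxx addr0; case: ifP => _; rewrite ?mul1r ?subrr ?mul0r ?subr0.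
rewrite mxE; case: eqP => [eqil|]; last by rewrite mul0r.
by case/eqP: neql; apply: val_inj.
Qed.

(** The square mask [copid_mx s] replaces the block of width L + 1 - s and its [inord] indices, so
    that unitarity of U applies directly. *)
Lemma noise_projE L s (U : 'M[C]_L.+1) : (s <= L)%N ->
  noise_proj s U = U *m copid_mx s *m U ^t*.
Proof.
move=> lesL; apply/matrixP => i j; rewrite -mulmxA !mxE.
pose F (k : 'I_L.+1) : C := U i k * (U j k)^*.
transitivity (\sum_(k < L.+1 | (s <= k)%N) F k).
  transitivity (\sum_(s <= k < L.+1) F (inord k)); last first.
    by rewrite big_geq_mkord; apply: eq_bigr => k _; rewrite inord_val.
  rewrite -{1}[s in RHS]add0n big_addn big_mkord.
  by apply: eq_bigr => k _; rewrite !mxE addnC.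
rewrite big_mkcond; apply: eq_bigr => k _.
rewrite copid_mulmxE !mxE ltnNge; case: ifP => _ //=.
by rewrite mulr0.
Qed.

Lemma noise_proj_adj L s (U : 'M[C]_L.+1) : (noise_proj s U) ^t* = noise_proj s U.
Proof. by rewrite /noise_proj trmx_mul map_mxM /= trmxCK. Qed.

Lemma noise_projK L s (U : 'M[C]_L.+1) : (s <= L)%N -> U \is unitarymx ->
  noise_proj s U *m noise_proj s U = noise_proj s U.
Proof.
move=> lesL Uu; rewrite noise_projE // -!mulmxA (mulmxA (U ^t*)) unitarymxK //.
by rewrite mul1mx (mulmxA (copid_mx s)) copid_mx_id // ltnW.
Qed.

Lemma l2norm_noise_proj_le L s (U : 'M[C]_L.+1) (v : 'cV[C]_L.+1) : (s <= L)%N -> U \is unitarymx ->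
  l2norm (noise_proj s U *m v) <= l2norm v.
Proof.
move=> lesL Uu.
rewrite noise_projE // -!mulmxA l2norm_unitary // -[leRHS](l2norm_adj_unitary _ Uu).
rewrite -(@ler_pXn2r _ 2) // ?nnegrE ?l2norm_ge0 // !sqr_l2norm.
apply: ler_sum => k _; rewrite copid_mulmxE; case: ifP => // _.
by rewrite (normcR 0) normr0 expr0n sqr_ge0.
Qed.

(** Projecting erases the first s singular values of A, so only the remaining ones bound the
    product. *)
Lemma l2norm_noise_proj_svd_le L n s (A : 'M[C]_(L.+1, n)) U sigma V (K : R) (w : 'cV[C]_n) :
  (s <= L)%N -> is_svd A U sigma V -> 0 <= K ->
  (forall k, (s <= k < minn L.+1 n)%N -> sigma k <= K) ->
  l2norm (noise_proj s U *m (A *m w)) <= K * l2norm w.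
Proof.
move=> lesL [Uu Vu s0 _ ->] K0 sK.
rewrite noise_projE // -!mulmxA (mulmxA (U ^t*) U) unitarymxK // mul1mx.
rewrite l2norm_unitary // -[in leRHS](l2norm_adj_unitary _ Vu) mulmxA.
have -> : copid_mx s *m rect_diag L.+1 n sigma =
    rect_diag L.+1 n (fun k => if (k < s)%N then 0 else sigma k).
  apply/matrixP => i j; rewrite copid_mulmxE !mxE.
  by case: eqP; case: ltnP.
apply: l2norm_rect_diag_le => // j ltj; left.
case: ltnP => [_|lesj]; first by rewrite lexx.
have ltjm : (j < minn L.+1 n)%N by rewrite leq_min ltj ltn_ord.
by rewrite s0 // sK // lesj.
Qed.

Lemma noise_proj_svd_eq0 L n s (A : 'M[C]_(L.+1, n)) U sigma V (w : 'cV[C]_n) :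
  (s <= L)%N -> is_svd A U sigma V ->
  (forall k, (s <= k < minn L.+1 n)%N -> sigma k = 0) ->
  noise_proj s U *m (A *m w) = 0.
Proof.
move=> lesL svdA s0; apply: l2norm_eq0; apply/eqP.
rewrite eq_le l2norm_ge0 andbT -(mul0r (l2norm w)).
by apply: l2norm_noise_proj_svd_le svdA _ _ => // k /s0 ->.
Qed.

(** A truncated pseudo-inverse. It serves both to solve A w = v on the signal space and to bound the
    rank of a diagonal matrix from below. *)
Lemma rect_diag_pinv m n s (sigma : nat -> R) : (s <= n)%N ->
  (forall k, (k < s)%N -> sigma k != 0) ->
  rect_diag m n sigma *m
    rect_diag n m (fun k => if (k < s)%N then (sigma k)^-1 else 0) = pid_mx s.
Proof.
move=> lesn s0; apply/matrixP => i j; rewrite !mxE.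
have [ltis|lesi] := ltnP i s; last first.
  rewrite andbF big1 // => l _; rewrite !mxE.
  by case: eqP => [<-|]; rewrite ?mul0r // ltnNge lesi /= if_same mulr0.
rewrite andbT (bigD1 (Ordinal (leq_trans ltis lesn))) //= big1 => [|l neql].
  rewrite !mxE eqxx addr0 /= ltis; case: eqP; rewrite ?mulr0 // => _.
  by rewrite -rmorphM /= divff ?s0.
rewrite !mxE; case: eqP => [eqil|]; last by rewrite mul0r.
by case/eqP: neql; apply: val_inj.
Qed.

(* The signal space is the range of [A], where [A] is inverted with norm
   [(sigma s.-1)^-1]. *)
Lemma l2norm_mulmx_signal_le L n p s (A : 'M[C]_(L.+1, n)) U sigma V
    (T : 'M[C]_(p, L.+1)) (K : R) (v : 'cV[C]_L.+1) :
  (s <= L)%N -> (s <= n)%N -> is_svd A U sigma V -> 0 < sigma s.-1 -> 0 <= K ->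
  (forall w, l2norm (T *m (A *m w)) <= K * l2norm w) ->
  l2norm (T *m (v - noise_proj s U *m v)) <= K / sigma s.-1 * l2norm v.
Proof.
move=> lesL lesn [Uu Vu s0 smono EA] ss0 K0 TK.
have ltsmin k : (k < s)%N -> (k < minn L.+1 n)%N.
  by move=> ltks; rewrite leq_min !(leq_trans ltks) // ltnW.
have ges k : (k < s)%N -> sigma s.-1 <= sigma k.
  move=> ltks; have s_gt0 : (0 < s)%N by exact: leq_ltn_trans ltks.
  by apply: smono; [rewrite -ltnS prednK | apply: ltsmin; rewrite prednK].
(* The truncated pseudo-inverse of A applied to v. The singular values it inverts are at least
   [sigma s.-1], the s-th largest since indices start at 0; this controls the norm of w. *)
pose w := V *m (rect_diag n L.+1 (fun k => if (k < s)%N then (sigma k)^-1 else 0)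
                *m (U ^t* *m v)).
have -> : v - noise_proj s U *m v = A *m w.
  rewrite noise_projE // EA /w -!mulmxA (mulmxA (V ^t*)) unitarymxK // mul1mx.
  rewrite (mulmxA (rect_diag _ _ _)) rect_diag_pinv // => [|k /ges h]; last first.
    by rewrite gt_eqF // (lt_le_trans ss0).
  rewrite /copid_mx mulmxBl mul1mx mulmxBr (mulmxA U (U ^t*)) (unitarymxP _) //.
  by rewrite mul1mx opprB addrC subrK.
apply: le_trans (TK w) _; rewrite -mulrA ler_wpM2l // /w l2norm_unitary //.
rewrite -[in leRHS](l2norm_adj_unitary v Uu).
apply: l2norm_rect_diag_le => [|j _]; first by rewrite invr_ge0 ltW.
left; case: ltnP => [/ges h|_]; last by rewrite lexx invr_ge0 ltW.
by rewrite invr_ge0 (le_trans (ltW ss0)) //= lef_pV2 // posrE (lt_le_trans ss0).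
Qed.

(** The constant is 3 = 2 + 1: one half of the splitting of the difference of projections costs 2 e,
    the other e. The two sides differ because A has exactly zero singular values beyond s, while
    those of B are only at most e. *)
Lemma noise_proj_perturbation L n s (A B : 'M[C]_(L.+1, n)) UA sA VA UB sB VB
    (u v : 'cV[C]_L.+1) :
  let e := spectral_norm (B - A) in
  (0 < s)%N -> (s <= L)%N -> (s <= n)%N ->
  is_svd A UA sA VA -> is_svd B UB sB VB ->
  (forall k, (s <= k < minn L.+1 n)%N -> sA k = 0) -> e < sA s.-1 ->
  `|rdot u ((noise_proj s UB - noise_proj s UA) *m v)|
    <= 3 * e / (sA s.-1 - e) * (l2norm u * l2norm v).
Proof.
move=> e s_gt0 lesL lesn svdA svdB sA0 es.
have BAe w : l2norm ((B - A) *m w) <= e * l2norm w by exact: l2norm_mulmx_le.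
have ABe w : l2norm ((A - B) *m w) <= e * l2norm w.
  by rewrite -opprB mulNmx l2normN.
have weylBA k : (k < minn L.+1 n)%N -> sB k <= sA k + e.
  exact: weyl svdB svdA.
have weylAB k : (k < minn L.+1 n)%N -> sA k <= sB k + e.
  rewrite /e -spectral_normN opprB; exact: weyl svdA svdB.
have e0 : 0 <= e by exact: spectral_norm_ge0.
clearbody e.
have [UAu _ _ _ _] := svdA; have [UBu _ _ _ _] := svdB.
set P := noise_proj s UA; set Q := noise_proj s UB.
have lts : (s.-1 < minn L.+1 n)%N.
  by rewrite leq_min prednK // lesn andbT leqW.
have sBge : sA s.-1 - e <= sB s.-1 by rewrite lerBlDr weylAB.
have sub0 : 0 < sA s.-1 - e by rewrite subr_gt0.
have sBle k : (s <= k < minn L.+1 n)%N -> sB k <= e.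
  by move=> hk; have /andP[_ /weylBA] := hk; rewrite sA0 // add0r.
(* P annihilates the range of A, so only the perturbation B - A contributes. *)
have PB w : l2norm (P *m (B *m w)) <= e * l2norm w.
  have -> : B *m w = A *m w + (B - A) *m w by rewrite -mulmxDl addrC subrK.
  rewrite mulmxDr (noise_proj_svd_eq0 _ lesL svdA) // add0r.
  by rewrite (le_trans (l2norm_noise_proj_le _ lesL UAu)).
(* One e comes from the singular values of B beyond s, the other from A - B. *)
have QA w : l2norm (Q *m (A *m w)) <= (2 * e) * l2norm w.
  have -> : A *m w = B *m w + (A - B) *m w by rewrite -mulmxDl addrC subrK.
  rewrite mulmxDr (le_trans (l2normD _ _)) // mulr2n (mulrDl 1 1) mul1r mulrDl lerD //.
    exact: l2norm_noise_proj_svd_le svdB e0 sBle.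
  by rewrite (le_trans (l2norm_noise_proj_le _ lesL UBu)) //.
(* The signal part of v is A w with |w| <= |v| / [sA s.-1]. The denominator is then weakened to the
   one that Weyl's inequality gives for B. *)
have bQ : l2norm (Q *m (v - P *m v)) <= 2 * e / (sA s.-1 - e) * l2norm v.
  have := l2norm_mulmx_signal_le v lesL lesn svdA (le_lt_trans e0 es) _ QA.
  move=> /(_ (mulr_ge0 (ler0n _ 2) e0)) /le_trans -> //.
  rewrite ler_wpM2r ?l2norm_ge0 // ler_wpM2l ?mulr_ge0 // lef_pV2 ?posrE //.
    by rewrite gerBl.
  exact: le_lt_trans es.
have bP : l2norm (P *m (u - Q *m u)) <= e / (sA s.-1 - e) * l2norm u.
  have := l2norm_mulmx_signal_le u lesL lesn svdB (lt_le_trans sub0 sBge) e0 PB.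
  move=> /le_trans -> //.
  rewrite ler_wpM2r ?l2norm_ge0 // ler_wpM2l // lef_pV2 ?posrE //.
  exact: lt_le_trans sBge.
have adjP x y : rdot x (P *m y) = rdot (P *m x) y by rewrite rdot_mulmx noise_proj_adj.
have adjQ x y : rdot x (Q *m y) = rdot (Q *m x) y by rewrite rdot_mulmx noise_proj_adj.
(* This is Q - P = Q (1 - P) - (1 - Q) P, with the second product moved onto u by self-adjointness,
   so that [bP] applies to it. *)
have -> : rdot u ((Q - P) *m v) = rdot u (Q *m (v - P *m v)) - rdot (P *m (u - Q *m u)) v.
  rewrite -adjP mulmxBl mulmxBr !rdotBr [rdot (u - _) _]rdotC rdotBr.
  rewrite [rdot (P *m v) (Q *m u)]adjQ ![rdot _ u]rdotC.
  move: (rdot u (Q *m v)) (rdot u (P *m v)) (rdot u (Q *m (P *m v))) => y z t; ring.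
apply: le_trans (ler_normB _ _) _.
apply: le_trans (lerD (rdot_le _ _) (rdot_le _ _)) _.
have := ler_wpM2l (l2norm_ge0 u) bQ; have := ler_wpM2r (l2norm_ge0 v) bP.
move: (sA s.-1 - e)^-1 (l2norm u) (l2norm v) (l2norm (Q *m _)) (l2norm (P *m _)).
move=> t y z a b; lra.
Qed.

End NoiseProjection.

(** * Hankel matrices of exponential sums *)

Section Frequencies.
Variable R : realType.
Local Notation C := R[i].

Lemma expiD (a b : R) : expi (a + b) = expi a * expi b.
Proof. by rewrite /expi sinD cosD; simpc; congr (_ +i* _); rewrite addrC. Qed.

Lemma expiMn (a : R) n : expi (a *+ n) = expi a ^+ n.
Proof.
elim: n => [|n IH]; first by rewrite mulr0n expr0 /expi cos0 sin0.
by rewrite mulrS exprS expiD IH.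
Qed.

Lemma conj_expi (a : R) : ((expi a)^*)%R = expi (- a).
Proof. by rewrite /expi sinN cosN. Qed.

Lemma phi_expr L (w : R) k : phi L w k 0 = expi (- (2 * pi * w)) ^+ k.
Proof. by rewrite mxE -expiMn; congr expi; rewrite -mulr_natl; ring. Qed.

(** If a < b, equal values force cos(2 pi (b - a)) = 1, hence sin(pi (b - a)) = 0. But 0 < b - a < 1
    makes this sine positive. *)
Lemma expi_frequency_inj (a b : R) : 0 <= a < 1 -> 0 <= b < 1 ->
  expi (- (2 * pi * a)) = expi (- (2 * pi * b)) -> a = b.
Proof.
wlog leab : a b / a <= b => [hw ha hb h|].
  by have [/hw|/ltW /hw] := leP a b; [exact|move=> ->].
move=> /andP[a0 _] /andP[_ b1] [].
rewrite !cosN !sinN => eqcos /oppr_inj eqsin; apply/eqP.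
rewrite eq_le leab /= leNgt; apply/negP => ltab.
have pi0 := pi_gt0 R.
have : 0 < sin (pi * (b - a)).
  apply: sin_gt0_pi; rewrite mulr_gt0 ?subr_gt0 //=.
  by rewrite -[ltRHS]mulr1 ltr_pM2l //; lra.
have : cos (pi * (b - a) + pi * (b - a)) = 1.
  have -> : pi * (b - a) + pi * (b - a) = 2 * pi * b - 2 * pi * a by ring.
  by rewrite cosB eqcos eqsin -!expr2 cos2Dsin2.
rewrite cosD -!expr2; have := cos2Dsin2 (pi * (b - a)).
set c := cos _; set d := sin _ => h1 h2 h3.
have : d ^+ 2 = 0 by lra.
by move/eqP; rewrite sqrf_eq0 => /eqP d0; rewrite d0 ltxx in h3.
Qed.

(** The exponential at a + b splits into a product, which gives the Vandermonde factorization. With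
    L <= M the index a + b never exceeds M, so [inord] does not overflow. *)
Lemma data_hankelE s L M (omega : 'I_s -> R) (x : 'I_s -> C) : (L <= M)%N ->
  hankel L (data M x omega) =
  (\matrix_(k, j) phi L (omega j) k 0) *m diag_mx (\row_j x j)
    *m (\matrix_(j, k) phi (M - L) (omega j) k 0).
Proof.
move=> leLM; apply/matrixP => a b; rewrite !mxE; apply: eq_bigr => j _.
rewrite mul_mx_diag !mxE inordK; last first.
  rewrite ltnS -[leqRHS](subnKC leLM).
  by rewrite leq_add // -ltnS ltn_ord.
rewrite [RHS]mulrAC [LHS]mulrC -expiD; congr (expi _ * _).
by rewrite natrD; ring.
Qed.

(** The first s columns form a square Vandermonde matrix whose nodes are distinct because the
    frequencies are. Its inverse, padded by zero rows, is the right inverse. *)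
Lemma frequency_matrix_pinv s N (omega : 'I_s -> R) : (s <= N.+1)%N ->
  (forall j, 0 <= omega j < 1) -> injective omega ->
  exists Y : 'M[C]_(N.+1, s), (\matrix_(j, k) phi N (omega j) k 0) *m Y = 1%:M.
Proof.
move=> lesN omega01 omega_inj; set G := \matrix_(j, k) _.
pose z : 'rV[C]_s := \row_j expi (- (2 * pi * omega j)).
have EG : G *m pid_mx s = (Vandermonde s z)^T.
  apply/matrixP => j k; rewrite !mxE.
  rewrite (bigD1 (widen_ord lesN k)) //= big1 => [|l neql].
    by rewrite !mxE eqxx /= ltn_ord mulr1 addr0 -(@phi_expr N _ (widen_ord lesN k)) !mxE.
  rewrite !mxE; case: eqP => [eqlk|]; last by rewrite mulr0.
  by case/eqP: neql; apply: val_inj.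
exists (pid_mx s *m invmx (Vandermonde s z)^T).
rewrite mulmxA EG mulmxV // unitmx_tr unitmxE det_Vandermonde unitfE.
apply/prodf_neq0 => i _; apply/prodf_neq0 => j ltij.
rewrite subr_eq0; apply: contraTneq ltij; rewrite !mxE => h.
by rewrite (omega_inj j i) ?ltnn //; exact: expi_frequency_inj.
Qed.

(** Were [sigma k] positive, so would be all earlier values, and the diagonal factor would have rank
    at least k + 1 > s. [is_svd] itself says nothing about the rank, so the zero tail has to be
    derived. *)
Lemma svd_rank_sigma_eq0 m n s (A : 'M[C]_(m, n)) U sigma V k :
  is_svd A U sigma V -> (\rank A <= s)%N -> (s <= k < minn m n)%N -> sigma k = 0.
Proof.
move=> [Uu Vu s0 smono EA] rkA /andP[lesk ltk].
have [ltkm ltkn] : (k < m /\ k < n)%N by apply/andP; rewrite -leq_min.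
apply/eqP; rewrite eq_le s0 // andbT leNgt; apply/negP => sk0.
have ne0 l : (l < k.+1)%N -> sigma l != 0.
  by rewrite ltnS => lelk; rewrite gt_eqF // (lt_le_trans sk0) // smono.
have := mxrankM_maxl (rect_diag m n sigma)
  (rect_diag n m (fun l => if (l < k.+1)%N then (sigma l)^-1 else 0)).
rewrite rect_diag_pinv // rank_pid_mx // => lek.
have ED : rect_diag m n sigma = U ^t* *m A *m V.
  rewrite EA -!mulmxA unitarymxK // mulmx1 mulmxA unitarymxK // mul1mx //.
have : (\rank (rect_diag m n sigma) <= \rank A)%N.
  rewrite ED (leq_trans (mxrankM_maxl _ _)) //; exact: mxrankM_maxr.
by move=> /(leq_trans lek) /leq_trans /(_ rkA); rewrite ltnNge lesk.
Qed.

Section Data.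
Variables (s L M : nat) (omega : 'I_s -> R) (x : 'I_s -> C).
Variables (U : 'M[C]_L.+1) (V : 'M[C]_((M - L).+1)) (sigma : nat -> R).
Hypothesis svdH : is_svd (hankel L (data M x omega)) U sigma V.
Hypothesis leLM : (L <= M)%N.

Lemma data_sigma_eq0 k : (s <= k < minn L.+1 (M - L).+1)%N -> sigma k = 0.
Proof.
apply: svd_rank_sigma_eq0 svdH _; rewrite data_hankelE // -mulmxA.
exact: leq_trans (mxrankM_maxl _ _) (rank_leq_col _).
Qed.

Lemma noise_proj_phi_eq0 j : (s <= L)%N -> (s <= (M - L).+1)%N ->
  (forall j, 0 <= omega j < 1) -> injective omega -> (forall j, x j != 0) ->
  noise_proj s U *m phi L (omega j) = 0.
Proof.
move=> lesL lesML omega01 omega_inj x_neq0.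
have [Y GY] := frequency_matrix_pinv lesML omega01 omega_inj.
set F : 'M[C]_(L.+1, s) := \matrix_(k, j) phi L (omega j) k 0.
(* Column j of the right inverse Y is a preimage of x_j phi(omega_j) under the Hankel matrix. The
   noise projection annihilates the range, and x_j is nonzero. *)
have HY : hankel L (data M x omega) *m (Y *m delta_mx j 0) = x j *: phi L (omega j).
  rewrite data_hankelE // mulmxA -(mulmxA _ _ Y) GY mulmx1 -/F -mulmxA.
  rewrite -[delta_mx j _]/(delta_mx j 0) mul_diag_mx.
  apply/matrixP => k l; rewrite ord1 !mxE (bigD1 j) //= big1 => [|i neqi].
    by rewrite !mxE !eqxx addr0 mulr1 mulrC.
  by rewrite !mxE (negbTE neqi) !mulr0.
have := noise_proj_svd_eq0 (Y *m delta_mx j 0) lesL svdH data_sigma_eq0.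
rewrite HY -scalemxAr => /eqP; rewrite scaler_eq0 (negbTE (x_neq0 j)) /=.
by move/eqP.
Qed.

End Data.

End Frequencies.

(** * Minimizers of a perturbed function *)

Section PerturbedMinimizer.
Variable R : realType.

Lemma is_derive_incr (f df : R -> R) (a b K : R) : a < b ->
  (forall w : R, is_derive w 1 f (df w)) ->
  (forall w, a < w < b -> K < df w) -> K * (b - a) < f b - f a.
Proof.
move=> ltab fdf Kdf.
have fc : {within `[a, b], continuous f}.
  by apply: derivable_within_continuous => w _; exact: (@ex_derive _ _ _ _ _ _ _ (fdf w)).
have [c] := MVT ltab (fun w _ => fdf w) fc.
by rewrite in_itv /= => /Kdf ltK ->; rewrite ltr_pM2r // subr_gt0.
Qed.

(** The one-variable argument in isolation: G is a perturbation of Q with first and second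
    derivatives within [tau] and [kappa] of those of Q. *)
Lemma perturbed_minimizer (Q Q1 Q2 G G1 G2 : R -> R) (a m tau kappa delta : R) :
  (forall w : R, is_derive w 1 Q (Q1 w)) -> (forall w : R, is_derive w 1 Q1 (Q2 w)) ->
  (forall w : R, is_derive w 1 G (G1 w)) -> (forall w : R, is_derive w 1 G1 (G2 w)) ->
  Q1 a = 0 -> 0 < delta ->
  (forall w, a - delta < w < a + delta -> m < Q2 w) ->
  (forall w, `|G1 w - Q1 w| <= tau) -> (forall w, `|G2 w - Q2 w| <= kappa) ->
  kappa < m / 2 -> tau < m * delta / 2 ->
  exists what, [/\ a - delta < what < a + delta,
    forall t, a - delta < t < a + delta -> t != what -> G what < G t &
    `|what - a| * inf [set `|Q2 xi| | xi in `]Num.min a what, Num.max a what[%classic]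
      <= tau].
Proof.
move=> dQ dQ1 dG dG1 Q1a delta0 mQ2 tauG kappaG ltkappa lttau.
have kappa0 : 0 <= kappa by apply: le_trans (kappaG a); exact: normr_ge0.
have tau0 : 0 <= tau by apply: le_trans (tauG a); exact: normr_ge0.
have m0 : 0 < m by lra.
have G2pos w : a - delta < w < a + delta -> 0 < G2 w.
  move=> /mQ2 h; have := kappaG w; rewrite ler_norml => /andP[h1 h2]; lra.
(* At distance delta / 2 the derivative of Q has already reached m delta / 2 > [tau], so its sign
   passes to G1. Halving delta also keeps the zero of G1 strictly inside the interval. *)
have G1r : 0 <= G1 (a + delta / 2).
  have := @is_derive_incr Q1 Q2 a (a + delta / 2) m.
  move=> /(_ _ dQ1 _) h; have {h} : m * (a + delta / 2 - a) < Q1 (a + delta / 2) - Q1 a.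
    by apply: h => [|w /andP[w1 w2]]; [lra | apply: mQ2; apply/andP; split; lra].
  have := tauG (a + delta / 2); rewrite ler_norml => /andP[h1 h2]; rewrite Q1a; lra.
have G1l : G1 (a - delta / 2) <= 0.
  have := @is_derive_incr Q1 Q2 (a - delta / 2) a m.
  move=> /(_ _ dQ1 _) h; have {h} : m * (a - (a - delta / 2)) < Q1 a - Q1 (a - delta / 2).
    by apply: h => [|w /andP[w1 w2]]; [lra | apply: mQ2; apply/andP; split; lra].
  have := tauG (a - delta / 2); rewrite ler_norml => /andP[h1 h2]; rewrite Q1a; lra.
have [what] : exists2 c, c \in `[a - delta / 2, a + delta / 2] & G1 c = 0.
  apply: IVT; first lra.
    by apply: derivable_within_continuous => w _; exact: (@ex_derive _ _ _ _ _ _ _ (dG1 w)).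
  by rewrite ge_min G1l le_max G1r orbT.
rewrite in_itv /= => /andP[wl wr] G10.
have wi : a - delta < what < a + delta by apply/andP; split; lra.
have [wia wib] := andP wi.
exists what; split => //.
- move=> t /andP[ta tb]; rewrite neq_lt => /orP[lttw|ltwt].
    (* Monotonicity is [is_derive_incr] with K = 0. On the left of [what] it is applied to the
       negative of G, since G1 increases to 0 there. *)
    have : 0 * (what - t) < - G what - - G t.
      apply: (@is_derive_incr (\- G) (\- G1)) => // w /andP[w1 w2].
      have : 0 * (what - w) < G1 what - G1 w.
        apply: (@is_derive_incr _ G2) => // u /andP[u1 u2].
        by apply: G2pos; apply/andP; split; lra.
      by rewrite G10 /=; lra.
    lra.
  have : 0 * (t - what) < G t - G what.
    apply: (@is_derive_incr _ G1) => // w /andP[w1 w2].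
    have : 0 * (w - what) < G1 w - G1 what.
      apply: (@is_derive_incr _ G2) => // u /andP[u1 u2].
      by apply: G2pos; apply/andP; split; lra.
    by rewrite G10 /=; lra.
  lra.
(* When [what] equals a the interval is empty, and the factor [|what - a|] makes the product 0
   whatever [inf] returns. *)
- have [->|neqw] := eqVneq what a; first by rewrite subrr normr0 mul0r.
  have [c cI eqc] : exists2 c, Num.min a what < c < Num.max a what &
      Q1 what = Q2 c * (what - a).
    have Q1c x y : {within `[x, y], continuous Q1}.
      by apply: derivable_within_continuous => w _; exact: (@ex_derive _ _ _ _ _ _ _ (dQ1 w)).
    move: neqw; rewrite neq_lt => /orP[lt|lt].
      have [c] := MVT lt (fun w _ => dQ1 w) (Q1c _ _).
      rewrite in_itv /= Q1a => cI h; exists c; last by lra.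
      by rewrite (min_idPr (ltW lt)) (max_idPl (ltW lt)).
    have [c] := MVT lt (fun w _ => dQ1 w) (Q1c _ _).
    rewrite in_itv /= Q1a => cI h; exists c; last by lra.
    by rewrite (min_idPl (ltW lt)) (max_idPr (ltW lt)).
  (* Since G1 vanishes at [what], Q1 is at most [tau] there; the infimum is at most the value at the
     mean value point c. *)
  have Q1w : `|Q1 what| <= tau by have := tauG what; rewrite G10 sub0r normrN.
  apply: le_trans Q1w; rewrite eqc normrM mulrC ler_wpM2r //.
  apply: ge_inf; first by exists 0 => _ [x _ <-].
  by exists c.
Qed.

End PerturbedMinimizer.

(** * Derivatives of the noise correlation *)

Section Derivatives.
Variable R : realType.
Local Notation C := R[i].

(** The order a is a parameter so that one product rule, [is_derive_rdot_phi], covers both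
    differentiations by raising an index. *)
Definition phi_deriv (a L : nat) (w : R) : 'cV[C]_L.+1 :=
  \col_(k < L.+1) ((0 +i* - (2 * pi * k%:R)) ^+ a * expi (- (2 * pi * k%:R * w))).

Lemma phi_deriv0 L w : phi_deriv 0 L w = phi L w.
Proof. by apply/matrixP => k j; rewrite !mxE expr0 mul1r. Qed.

(** The complex constant c is arbitrary so that imaginary parts are covered too: Im z is the real
    part of -i z. *)
Lemma is_derive_Re_expi (c : C) (a w : R) :
  is_derive w 1 (fun t => complex.Re (c * expi (a * t)))
    (complex.Re ((0 +i* a) * (c * expi (a * w)))).
Proof.
case: c => p q.
have da : is_derive w 1 (fun t : R => a * t) a.
  by have := is_deriveZ a (is_derive_id w (1 : R)); rewrite /GRing.scale /= mulr1.
have dcos : is_derive w 1 (fun t => cos (a * t)) (- sin (a * w) * a).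
  exact: (@is_derive1_comp _ cos).
have dsin : is_derive w 1 (fun t => sin (a * t)) (cos (a * w) * a).
  exact: (@is_derive1_comp _ sin).
rewrite /expi /=.
have := is_deriveB (is_deriveZ p dcos) (is_deriveZ q dsin).
move=> /is_derive_eq; apply.
by rewrite /GRing.scale /=; ring.
Qed.

Lemma is_derive_sum_fun n (h : 'I_n -> R -> R) (dh : 'I_n -> R) (w : R) :
  (forall i, is_derive w 1 (h i) (dh i)) ->
  is_derive w 1 (fun t => \sum_i h i t) (\sum_i dh i).
Proof.
move=> hd; have := is_derive_sum hd.
by congr (is_derive _ _ _ _); apply/funext => t; rewrite fct_sumE.
Qed.

Lemma rdot_mulmxE m n (A : 'M[C]_(m, n)) u v :
  rdot u (A *m v) = \sum_k \sum_l complex.Re ((u k 0)^* * A k l * v l 0).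
Proof.
rewrite rdotE; apply: eq_bigr => k _.
rewrite mxE mulr_sumr raddf_sum; apply: eq_bigr => l _.
by rewrite mulrA.
Qed.

(** Each term of the double sum is a constant times an exponential of frequency th k - th l.
    Differentiating multiplies it by i (th k - th l), the sum of the conjugate of -i th k, which
    raises a, and of -i th l, which raises b. *)
Lemma is_derive_rdot_phi L (A : 'M[C]_L.+1) a b (w : R) :
  is_derive w 1 (fun t => rdot (phi_deriv a L t) (A *m phi_deriv b L t))
    (rdot (phi_deriv a.+1 L w) (A *m phi_deriv b L w)
     + rdot (phi_deriv a L w) (A *m phi_deriv b.+1 L w)).
Proof.
pose th (k : 'I_L.+1) : R := 2 * pi * k%:R.
pose c k l := (((0 +i* - th k) ^+ a)^* * A k l * (0 +i* - th l) ^+ b : C).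
have E t k l : (phi_deriv a L t k 0)^* * A k l * phi_deriv b L t l 0 =
    c k l * expi ((th k - th l) * t).
  have conjM (y z : C) : ((y * z)^*)%R = y^* * z^* by exact: rmorphM.
  rewrite !mxE conjM conj_expi mulrBl expiD opprK /c -/(th k) -/(th l); ring.
rewrite (_ : (fun t => _) =
    fun t => \sum_k \sum_l complex.Re (c k l * expi ((th k - th l) * t))); last first.
  apply/funext => t; rewrite rdot_mulmxE; apply: eq_bigr => k _.
  by apply: eq_bigr => l _; rewrite E.
rewrite (_ : _ + _ = \sum_k \sum_l
    complex.Re ((0 +i* (th k - th l)) * (c k l * expi ((th k - th l) * w)))).
  apply: is_derive_sum_fun => k; apply: is_derive_sum_fun => l.
  exact: is_derive_Re_expi.
rewrite !rdot_mulmxE -big_split; apply: eq_bigr => k _.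
rewrite -big_split; apply: eq_bigr => l _.
have ReD (y z : C) : complex.Re (y + z) = complex.Re y + complex.Re z.
  by case: y z => [? ?] [].
rewrite -E -[LHS]ReD; congr complex.Re.
have -> : (0 +i* (th k - th l) : C) = (0 +i* - th k)^* + (0 +i* - th l).
  by apply/eqP; rewrite eq_complex /= addr0 opprK !eqxx.
rewrite !mxE !exprS -/(th k) -/(th l) !rmorphM /=; ring.
Qed.

Lemma vderive_phi L w : vderive (phi L) w = phi_deriv 1 L w.
Proof.
apply/matrixP => k j; rewrite !mxE expr1.
have E (c : C) : (fun t : R => complex.Re (c * phi L t k 0)) =
    fun t : R => complex.Re (c * expi (- (2 * pi * k%:R) * t)).
  by apply/funext => t; rewrite mxE mulNr.
have ERe : (fun t : R => complex.Re (phi L t k 0)) =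
    fun t : R => complex.Re (1 * expi (- (2 * pi * k%:R) * t)).
  by rewrite -(E 1); apply/funext => t; rewrite mul1r.
have EIm : (fun t : R => complex.Im (phi L t k 0)) =
    fun t : R => complex.Re ((0 +i* -1) * expi (- (2 * pi * k%:R) * t)).
  by rewrite -(E (0 +i* -1)); apply/funext => t; case: (phi L t k 0) => p q /=; ring.
have derive_Re_expi (c : C) (a : R) : 'D_1 (fun t : R => complex.Re (c * expi (a * t))) w =
    complex.Re ((0 +i* a) * (c * expi (a * w))).
  by case: (is_derive_Re_expi c a w).
rewrite ERe EIm !derive1E.
rewrite derive_Re_expi.
rewrite derive_Re_expi.
by rewrite mulNr /expi; simpc; congr (_ +i* _) => /=; ring.
Qed.

Lemma sqr_l2norm_phi_deriv a L w :
  l2norm (phi_deriv a L w) ^+ 2 = \sum_(k < L.+1) ((2 * pi * k%:R) ^+ a) ^+ 2.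
Proof.
rewrite sqr_l2norm; apply: eq_bigr => k _; rewrite mxE ComplexField.Normc.normcM.
have -> : ComplexField.Normc.normc (expi (- (2 * pi * k%:R * w))) = 1.
  by rewrite /= cos2Dsin2 sqrtr1.
have -> : ComplexField.Normc.normc ((0 +i* - (2 * pi * k%:R)) ^+ a)
    = (2 * pi * k%:R) ^+ a :> R.
  elim: a => [|a IH]; first by rewrite !expr0 (normcR 1) normr1.
  rewrite !exprS ComplexField.Normc.normcM IH /= expr0n add0r sqrrN sqrtr_sqr.
  by rewrite ger0_norm // !mulr_ge0 // pi_ge0.
by rewrite mulr1.
Qed.

Lemma l2norm_phi0 L w : l2norm (phi_deriv 0 L w) = Num.sqrt L.+1%:R.
Proof.
apply/eqP; rewrite -(@eqrXn2 _ 2) ?l2norm_ge0 ?sqrtr_ge0 //.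
rewrite sqr_l2norm_phi_deriv sqr_sqrtr //.
by under eq_bigr do rewrite expr0 expr1n; rewrite sumr_const card_ord.
Qed.

Lemma sum_ord_natr L (F : nat -> R) : F 0%N = 0 ->
  \sum_(k < L.+1) F k = \sum_(1 <= k < L.+1) F k.
Proof. by move=> F0; rewrite -(big_mkord xpredT) big_nat_recl // F0 add0r big_add1. Qed.

(** Entries of [phi_deriv] have modulus independent of w. Thus [eta] is the constant ratio of the
    norms of the first derivative and of [phi]; [zeta] plays the same part for the second
    derivative. *)
Lemma l2norm_phi1 L w : l2norm (phi_deriv 1 L w) = eta L * Num.sqrt L.+1%:R.
Proof.
rewrite /eta divfK ?gt_eqF ?sqrtr_gt0 //.
apply/eqP; rewrite -(@eqrXn2 _ 2) ?l2norm_ge0 ?mulr_ge0 ?sqrtr_ge0 ?pi_ge0 //.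
rewrite sqr_l2norm_phi_deriv exprMn sqr_sqrtr; last by apply: sumr_ge0 => k _; rewrite exprn_ge0.
rewrite mulr_sumr (sum_ord_natr _ (F := fun k => (2 * pi * k%:R) ^+ 1 ^+ 2)).
  by apply/eqP/eq_bigr => k _; rewrite expr1 exprMn.
by rewrite expr1 mulr0 expr0n.
Qed.

Lemma l2norm_phi2 L w : l2norm (phi_deriv 2 L w) = zeta L * Num.sqrt L.+1%:R.
Proof.
rewrite /zeta divfK ?gt_eqF ?sqrtr_gt0 //.
apply/eqP; rewrite -(@eqrXn2 _ 2) ?l2norm_ge0 ?mulr_ge0 ?sqrtr_ge0 ?pi_ge0 //.
rewrite sqr_l2norm_phi_deriv exprMn sqr_sqrtr; last by apply: sumr_ge0 => k _; rewrite exprn_ge0.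
rewrite mulr_sumr (sum_ord_natr _ (F := fun k => (2 * pi * k%:R) ^+ 2 ^+ 2)).
  by apply/eqP/eq_bigr => k _; ring.
by rewrite mulr0 !expr0n.
Qed.

Lemma sqr_sqrt_natr n : Num.sqrt n%:R ^+ 2 = n%:R :> R.
Proof. by rewrite sqr_sqrtr. Qed.

Section NoiseCorrelation.
Variables (L s : nat) (U : 'M[C]_L.+1).
Hypothesis (lesL : (s <= L)%N) (Uu : U \is unitarymx).
Let P := noise_proj s U.

Let q a b w := rdot (phi_deriv a L w) (P *m phi_deriv b L w).

Definition noise_corr_sqr1 w : R := (q 1 0 w + q 0 1 w) / L.+1%:R.
Definition noise_corr_sqr2 w : R := (q 2 0 w + 2 * q 1 1 w + q 0 2 w) / L.+1%:R.

(** The projection is self-adjoint and idempotent, so the squared norm is a quadratic form, and the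
    denominator is constant in w. *)
Lemma noise_corr_sqrE w : noise_corr s U w ^+ 2 = q 0 0 w / L.+1%:R.
Proof.
rewrite /noise_corr expr_div_n -phi_deriv0 l2norm_phi0 sqr_sqrt_natr; congr (_ / _).
by rewrite -rdotvv -/P rdot_mulmx noise_proj_adj mulmxA noise_projK // /q rdot_mulmx noise_proj_adj.
Qed.

Lemma is_derive_divr (f : R -> R) (df c w : R) : is_derive w 1 f df ->
  is_derive w 1 (fun t => f t / c) (df / c).
Proof.
move=> fdf; have := is_deriveZ c^-1 fdf; rewrite /GRing.scale /= mulrC.
by congr (is_derive _ _ _ _); apply/funext => t; rewrite /= mulrC.
Qed.

Lemma is_derive_noise_corr_sqr (w : R) :
  is_derive w 1 (fun w => noise_corr s U w ^+ 2) (noise_corr_sqr1 w).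
Proof.
rewrite (_ : (fun w => _) = fun w => q 0 0 w / L.+1%:R).
  exact: is_derive_divr (is_derive_rdot_phi _ _ _ _).
by apply/funext => t; rewrite noise_corr_sqrE.
Qed.

Lemma is_derive_noise_corr_sqr1 (w : R) :
  is_derive w 1 noise_corr_sqr1 (noise_corr_sqr2 w).
Proof.
have := is_derive_divr L.+1%:R
  (is_deriveD (is_derive_rdot_phi P 1 0 w) (is_derive_rdot_phi P 0 1 w)).
move=> /is_derive_eq; apply.
rewrite -!/(q _ _ _) /noise_corr_sqr2; congr (_ / _).
move: (q 2 0 w) (q 1 1 w) (q 0 2 w) => x y z; ring.
Qed.

Lemma derive1n2_noise_corr_sqr :
  derive1n 2 (fun w => noise_corr s U w ^+ 2) = noise_corr_sqr2.
Proof.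
apply/funext => w; rewrite derive1nS derive1n1.
rewrite (_ : derive1 (fun w => noise_corr s U w ^+ 2) = noise_corr_sqr1); last first.
  apply/funext => t; rewrite derive1E.
  by case: (is_derive_noise_corr_sqr t).
rewrite derive1E.
by case: (is_derive_noise_corr_sqr1 w).
Qed.

(** Every term containing an underived [phi] vanishes; only the mixed term survives. At a true
    frequency this gives the critical point and the positive curvature. *)
Lemma noise_corr_sqr_zero w : P *m phi L w = 0 ->
  noise_corr_sqr1 w = 0 /\
  noise_corr_sqr2 w = 2 * l2norm (P *m phi_deriv 1 L w) ^+ 2 / L.+1%:R.
Proof.
rewrite -phi_deriv0 => P0.
have qa0 a : q a 0 w = 0 by rewrite /q P0 /rdot mulmx0 mxE.
have q0b b : q 0 b w = 0.
  by rewrite /q rdot_mulmx noise_proj_adj P0 rdotC /rdot mulmx0 mxE.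
rewrite /noise_corr_sqr1 /noise_corr_sqr2 !qa0 !q0b !(addr0, add0r) mul0r; split=> //.
congr (2 * _ / _).
by rewrite -rdotvv -/P [RHS]rdot_mulmx noise_proj_adj mulmxA noise_projK // /q rdot_mulmx noise_proj_adj.
Qed.

End NoiseCorrelation.

(** Bounding term by term gives eta + eta for the first derivative and zeta + 2 eta^2 + zeta for the
    second. The two factors sqrt(L + 1) from the norms cancel the denominator. *)
Lemma noise_corr_sqr_perturbation L s (U Ue : 'M[C]_L.+1) (K w : R) :
  (forall u v, `|rdot u ((noise_proj s Ue - noise_proj s U) *m v)|
     <= K * (l2norm u * l2norm v)) ->
  `|noise_corr_sqr1 s Ue w - noise_corr_sqr1 s U w| <= 2 * K * eta L /\
  `|noise_corr_sqr2 s Ue w - noise_corr_sqr2 s U w| <= 2 * K * (eta L ^+ 2 + zeta L).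
Proof.
move=> DK; pose N : R := L.+1%:R.
have N0 : 0 < N by rewrite ltr0n.
have [r rE] : exists r : R, r = Num.sqrt N by exists (Num.sqrt N).
have sN : r * r = N by rewrite rE -expr2 sqr_sqrt_natr.
pose q V a b := rdot (phi_deriv a L w) (noise_proj s V *m phi_deriv b L w).
have D a b : `|q Ue a b - q U a b|
    <= K * (l2norm (phi_deriv a L w) * l2norm (phi_deriv b L w)).
  by rewrite -rdot_mulmx_diff; exact: DK.
have E1 V : noise_corr_sqr1 s V w = (q V 1%N 0%N + q V 0%N 1%N) / N by [].
have E2 V : noise_corr_sqr2 s V w = (q V 2 0%N + 2 * q V 1%N 1%N + q V 0%N 2) / N by [].
have := (D 0%N 1%N, D 1%N 0%N, D 1%N 1%N, D 0%N 2, D 2 0%N).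
rewrite l2norm_phi0 l2norm_phi1 l2norm_phi2 -/N -rE !E1 !E2 => -[[[[h01 h10] h11] h02] h20].
clear D E1 E2 DK rE; clearbody q N; move: (eta L) (zeta L) h01 h10 h11 h02 h20 => y z.
move: (q U 0%N 1%N) (q U 1%N 0%N) (q U 1%N 1%N) (q U 0%N 2) (q U 2 0%N).
move: (q Ue 0%N 1%N) (q Ue 1%N 0%N) (q Ue 1%N 1%N) (q Ue 0%N 2) (q Ue 2 0%N).
move=> b01 b10 b11 b02 b20 a01 a10 a11 a02 a20 h01 h10 h11 h02 h20.
have hN (x c : R) : `|x| <= c * N -> `|x / N| <= c.
  by move=> h; rewrite normrM (gtr0_norm (x := N^-1)) ?invr_gt0 // ler_pdivrMr.
rewrite -!mulrBl; split; apply: hN.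
  rewrite (_ : _ - _ = (b10 - a10) + (b01 - a01)); last by ring.
  apply: le_trans (ler_normD _ _) _; apply: le_trans (lerD h10 h01) _.
  by rewrite -sN le_eqVlt; apply/orP; left; apply/eqP; ring.
rewrite (_ : _ - _ = (b20 - a20) + 2 * (b11 - a11) + (b02 - a02)); last by ring.
apply: le_trans (ler_normD _ _) _.
apply: le_trans (lerD (ler_normD _ _) h02) _; rewrite normrM ger0_norm //.
apply: le_trans (lerD (lerD h20 (ler_wpM2l _ h11)) (lexx _)) _ => //.
by rewrite -sN le_eqVlt; apply/orP; left; apply/eqP; ring.
Qed.

End Derivatives.

(** * Scalar estimates and the proof of the theorem *)

Section Estimates.
Variable R : realType.

Lemma noise_corr_ge0 L s (U : 'M[R[i]]_L.+1) (w : R) : 0 <= noise_corr s U w.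
Proof. by rewrite divr_ge0 // l2norm_ge0. Qed.

(** Passes from the constant of [noise_proj_perturbation] to 2 alpha e. Cleared of denominators and
    of e, it reads 3 (sigma_s - e) <= 2 (4 sigma_1 + 2 e). *)
Lemma perturbation_constant_le (e sigma1 sigmas : R) :
  0 <= e -> e < sigmas -> sigmas <= sigma1 ->
  3 * e / (sigmas - e) <= 2 * ((4 * sigma1 + 2 * e) / (sigmas - e) ^+ 2) * e.
Proof.
move=> e0 es s1; have d0 : 0 < sigmas - e by rewrite subr_gt0.
rewrite ler_pdivrMr //.
have -> : 2 * ((4 * sigma1 + 2 * e) / (sigmas - e) ^+ 2) * e * (sigmas - e)
    = (2 * (4 * sigma1 + 2 * e)) * e / (sigmas - e).
  by field; rewrite gt_eqF.
rewrite ler_pdivlMr // mulrAC ler_wpM2r //; lra.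
Qed.

(** Squaring preserves strict order on nonnegative reals. The analysis can thus be done on the
    square, which is smooth even where the noise correlation itself vanishes. *)
Lemma strict_local_minimizer_sqr (f : R -> R) (a b c : R) : (forall t, 0 <= f t) ->
  a < c < b -> (forall t, a < t < b -> t != c -> f c ^+ 2 < f t ^+ 2) ->
  strict_local_minimizer f c.
Proof.
move=> f0 cI fc.
change (\forall t \near c, t != c -> f c < f t).
have : \forall t \near c, t \in `]a, b[ by apply: near_in_itvoo; rewrite in_itv.
apply: filterS => t; rewrite in_itv /= => tI tc.
by rewrite -(@ltr_pXn2r _ 2) ?nnegrE // fc.
Qed.

End Estimates.

Theorem theorem4 (R : realType) (s L M : nat)
    (s_gt0 : (0 < s)%N) (L_ge1 : (1 <= L)%N) (ltLM : (L < M)%N)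
    (omega : 'I_s -> R) (omega_itv : forall j, 0 <= omega j < 1)
    (omega_inj : injective omega)
    (x : 'I_s -> R[i]) (x_neq0 : forall j, x j != 0)
    (eps : 'cV[R[i]]_M.+1)
    (U Ue : 'M[R[i]]_L.+1) (V Ve : 'M[R[i]]_((M - L).+1))
    (sigma sigmae : nat -> R)
    (svdH : is_svd (hankel L (data M x omega)) U sigma V)
    (svdHe : is_svd (hankel L (data M x omega + eps)) Ue sigmae Ve)
    (leqsL : (s <= L)%N) (leqsML : (s <= M - L + 1)%N)
    (dphi_neq0 : forall j, noise_proj s U *m vderive (phi L) (omega j) != 0) :
  let Q := fun w : R => noise_corr s U w ^+ 2 in
  let Q2 := derive1n 2 Q in
  let Reps := noise_corr s Ue in
  let normE := spectral_norm (hankel L eps) in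
  let sigma1 := sigma 0%N in
  let sigmas := sigma s.-1 in
  let alpha := (4 * sigma1 + 2 * normE) / (sigmas - normE) ^+ 2 in
  forall j : 'I_s,
  let m := Q2 (omega j) / 2 in
  0 < m /\
  forall delta : R, 0 < delta ->
    (forall w, omega j - delta < w < omega j + delta -> m < Q2 w) ->
    normE < sigmas ->
    4 * alpha * (eta L ^+ 2 + zeta L) * normE < m / 2 ->
    4 * alpha * eta L * normE < m * delta / 2 ->
    exists what : R,
      [/\ omega j - delta < what < omega j + delta,
          strict_local_minimizer Reps what &
          `|what - omega j| *
            inf [set `|Q2 xi| | xi in
                   `]Num.min (omega j) what, Num.max (omega j) what[%classic]
          <= 4 * alpha * eta L * normE].
Proof.
move=> Q Q2 Reps normE sigma1 sigmas alpha j m.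
have leLM : (L <= M)%N := ltnW ltLM.
have lesML : (s <= (M - L).+1)%N by rewrite -addn1.
have [Uu _ _ sigma_mono _] := svdH; have [Ueu _ _ _ _] := svdHe.
have Q2E : Q2 = noise_corr_sqr2 s U by exact: derive1n2_noise_corr_sqr.
have P0 : noise_proj s U *m phi L (omega j) = 0.
  exact: (noise_proj_phi_eq0 svdH).
have [Q10 Q2j] := noise_corr_sqr_zero leqsL Uu P0.
split.
  (* The curvature is a positive multiple of the squared norm of the projected derivative of [phi],
     nonzero by [dphi_neq0]. *)
  rewrite /m Q2E Q2j -vderive_phi.
  by rewrite !divr_gt0 ?mulr_gt0 ?ltr0n ?exprn_gt0 ?l2norm_gt0.
move=> delta delta0 mQ2 es ltkappa lttau.
have e0 : 0 <= normE by exact: spectral_norm_ge0.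
have sigma1_ge : sigmas <= sigma1.
  by apply: sigma_mono; rewrite // prednK // leq_min lesML ltnW.
have EE : hankel L (data M x omega + eps) - hankel L (data M x omega) = hankel L eps.
  by apply/matrixP => a b; rewrite !mxE addrC addKr.
have DK u v : `|rdot u ((noise_proj s Ue - noise_proj s U) *m v)|
    <= 2 * alpha * normE * (l2norm u * l2norm v).
  have := noise_proj_perturbation u v s_gt0 leqsL lesML svdH svdHe.
  rewrite EE => /(_ (@data_sigma_eq0 _ _ _ _ _ _ _ _ _ svdH leLM) es) /le_trans; apply.
  by rewrite ler_wpM2r ?mulr_ge0 ?l2norm_ge0 // perturbation_constant_le.
have mQ2' w : omega j - delta < w < omega j + delta -> m < noise_corr_sqr2 s U w.
  by rewrite -Q2E; exact: mQ2.
have dK w := noise_corr_sqr_perturbation w DK.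
(* Two derivative terms, each carrying K = 2 alpha e, produce the factor 4 alpha of the
   statement. *)
have twoK (y : R) : 2 * (2 * alpha * normE) * y = 4 * alpha * y * normE by ring.
have d1 w : `|noise_corr_sqr1 s Ue w - noise_corr_sqr1 s U w| <= 4 * alpha * eta L * normE.
  by rewrite -twoK; case: (dK w).
have d2 w : `|noise_corr_sqr2 s Ue w - noise_corr_sqr2 s U w|
    <= 4 * alpha * (eta L ^+ 2 + zeta L) * normE.
  by rewrite -twoK; case: (dK w).
have [what [whatI whatmin whatle]] := perturbed_minimizer
  (is_derive_noise_corr_sqr leqsL Uu) (is_derive_noise_corr_sqr1 s U)
  (is_derive_noise_corr_sqr leqsL Ueu) (is_derive_noise_corr_sqr1 s Ue)
  Q10 delta0 mQ2' d1 d2 ltkappa lttau.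
exists what; split => //; last by rewrite Q2E.
exact: strict_local_minimizer_sqr (noise_corr_ge0 s Ue) whatI whatmin.
Qed.
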